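(* Let $u^1_t=f^1_x$, $u^2_t=f^2_x$ be a strictly hyperbolic two-component system of conservation laws with Riemann invariants $R^1,R^2$ and characteristic velocities $\lambda^1,\lambda^2$. Let $u^1_\tau=q^1_x$, $u^2_\tau=q^2_x$ be a commuting flow of this system with characteristic velocities $\mu^1,\mu^2$. Consider in $A^3$ (coordinates $y^0,y^1,y^2$) the congruence of lines $l$: $y^1=u^1y^0-f^1$, $y^2=u^2y^0-f^2$, and the two-parameter family of planes $\pi=\pi(R^1,R^2)$ $$\frac{y^1-u^1y^0+f^1}{q^1}=\frac{y^2-u^2y^0+f^2}{q^2}.$$ Then: 1. each plane $\pi$ of the family contains a line $l$ of the congruence; 2. the congruence of lines $l_1=\pi\cap\partial_1\pi$ is conjugate to the focal surface $\mathbf r_1$ of the congruence $l$, and similarly the congruence of lines $l_2=\pi\cap\partial_2\pi$ is conjugate to the focal surface $\mathbf r_2$. The line $l_1$ (resp. $l_2$), called a characteristic of the plane $\pi$, meets the line $l$ in the point of tangency of $l$ with the focal surface $\mathbf r_1$ (resp. $\mathbf r_2$).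
   Context: Any two-component system of this kind is diagonalizable: in Riemann invariants the system takes the form $R^i_t=\lambda^iR^i_x$ and the commuting flow takes the form $R^i_\tau=\mu^iR^i_x$ ($i=1,2$, no summation). Strict hyperbolicity means that $\lambda^1,\lambda^2$ are real and distinct. A commuting flow is a system of conservation laws $u^i_\tau=q^i_x$, with $q^i$ functions of $u^1,u^2$, such that $u^i_{t\tau}=u^i_{\tau t}$. With $\partial_i=\partial/\partial R^i$, the densities $u=(u^1,u^2)$ and fluxes $f=(f^1,f^2)$, $q=(q^1,q^2)$ satisfy $\partial_if=\lambda^i\partial_iu$ and $\partial_iq=\mu^i\partial_iu$, $i=1,2$. By $\partial_i\pi$ is meant the plane whose equation is obtained by differentiating the equation of $\pi$ with respect to $R^i$ with $y^0,y^1,y^2$ fixed. The focal surfaces of the congruence $l$ are $\mathbf r_i=(y^0,y^1,y^2)=(\lambda^i,\ u^1\lambda^i-f^1,\ u^2\lambda^i-f^2)$, $i=1,2$; the line $l$ is tangent to $\mathbf r_i$ at the point with $y^0=\lambda^i$. A congruence of lines (a two-parameter family of lines in $A^3$) and a surface are conjugate if the developable surfaces of the congruence meet the surface in the curves of a conjugate net; a net $R^1,R^2$ on a surface with radius-vector $\mathbf r(R^1,R^2)$ is conjugate if $\partial_1\partial_2\mathbf r$ lies in the tangent plane of the surface.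
   Formalization: Assumes q¹,q² not both zero, l_i lines and r_i a regular surface; that developables of l_i meet r_i in net curves is claimed only along lines where not every direction is developable (for q=f all l_i pass through one point and every ruled surface is developable). *)

(* Defs.v *)
From Stdlib Require Import Reals Lra.
From Coquelicot Require Import Coquelicot.
Open Scope R_scope.

(** * Functions of two variables *)

(* The two values index components of u, f, q as well as the variables
   (R^1, R^2), resp. (u^1, u^2). *)
Inductive idx := I1 | I2.

Definition pd (i : idx) (F : R -> R -> R) (x1 x2 : R) : R :=
  match i with
  | I1 => Derive (fun t => F t x2) x1
  | I2 => Derive (fun t => F x1 t) x2
  end.

Definition open_2d (D : R -> R -> Prop) : Prop :=
  forall x1 x2, D x1 x2 -> locally_2d D x1 x2.

Definition Cn_on (n : nat) (D : R -> R -> Prop) (F : R -> R -> R) : Prop :=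
  forall x1 x2, D x1 x2 -> ex_diff_n F n x1 x2.

Definition sum_idx (g : idx -> R) : R := g I1 + g I2.

(** * Systems of conservation laws *)

(* [f], [q] are functions of (u^1, u^2); [u] gives u^1, u^2 as functions of
   (R^1, R^2); [pull u F] is F expressed through (R^1, R^2). *)
Definition pull (u : idx -> R -> R -> R) (F : R -> R -> R) (x1 x2 : R) : R :=
  F (u I1 x1 x2) (u I2 x1 x2).

Definition coordinates (D : R -> R -> Prop) (u : idx -> R -> R -> R) : Prop :=
  forall x1 x2, D x1 x2 ->
    pd I1 (u I1) x1 x2 * pd I2 (u I2) x1 x2
    - pd I2 (u I1) x1 x2 * pd I1 (u I2) x1 x2 <> 0.

(* The system u_t = g(u)_x reads R^i_t = v^i R^i_x in the variables R^1, R^2: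
   the partial derivatives satisfy d_i g^k = v^i d_i u^k. *)
Definition diagonal_form (D : R -> R -> Prop)
    (u g v : idx -> R -> R -> R) : Prop :=
  forall i k x1 x2, D x1 x2 ->
    pd i (pull u (g k)) x1 x2 = v i x1 x2 * pd i (u k) x1 x2.

Definition strictly_hyperbolic (D : R -> R -> Prop)
    (lam : idx -> R -> R -> R) : Prop :=
  forall x1 x2, D x1 x2 -> lam I1 x1 x2 <> lam I2 x1 x2.

(* The derivative of g^k(u) along the flow that moves the profile x |-> U x
   with velocity h(U)_x. *)
Definition evolve (g h : idx -> R -> R -> R) (U : idx -> R -> R)
    (k : idx) (x : R) : R :=
  sum_idx (fun j => pd j (g k) (U I1 x) (U I2 x)
                    * Derive (fun z => h j (U I1 z) (U I2 z)) x).

(* u_{t tau} = u_{tau t} for u_t = f_x, u_tau = q_x. By the first equation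
   u_{t tau} is the x-derivative of f(u)_tau, which [evolve f q] computes on an
   arbitrary initial profile; symmetrically for u_{tau t}. *)
Definition commuting_flow (V : R -> R -> Prop)
    (f q : idx -> R -> R -> R) : Prop :=
  forall (U : idx -> R -> R) (x : R),
    (forall k n z, ex_derive_n (U k) n z) ->
    V (U I1 x) (U I2 x) ->
    forall k, Derive (evolve f q U k) x = Derive (evolve q f U k) x.

(** * The affine space A^3 *)

Definition A3 := (R * R * R)%type.
Definition y0 (y : A3) : R := fst (fst y).
Definition y1 (y : A3) : R := snd (fst y).
Definition y2 (y : A3) : R := snd y.

Definition zero3 : A3 := (0, 0, 0).

Definition lin (s : R) (a : A3) (t : R) (b : A3) : A3 :=
  (s * y0 a + t * y0 b, s * y1 a + t * y1 b, s * y2 a + t * y2 b).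

Definition det3 (a b c : A3) : R :=
  y0 a * (y1 b * y2 c - y2 b * y1 c)
  - y1 a * (y0 b * y2 c - y2 b * y0 c)
  + y2 a * (y0 b * y1 c - y1 b * y0 c).

Definition line (p d y : A3) : Prop := exists t, y = lin 1 p t d.

Definition is_line (S : A3 -> Prop) : Prop :=
  exists p d, d <> zero3 /\ forall y, S y <-> line p d y.

Definition in_span (v a b : A3) : Prop := exists s t, v = lin s a t b.

Definition independent (a b : A3) : Prop :=
  forall s t, lin s a t b = zero3 -> s = 0 /\ t = 0.

Definition ex_derive3 (p : R -> A3) (s : R) : Prop :=
  ex_derive (fun z => y0 (p z)) s /\ ex_derive (fun z => y1 (p z)) s
  /\ ex_derive (fun z => y2 (p z)) s.

Definition Derive3 (p : R -> A3) (s : R) : A3 :=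
  (Derive (fun z => y0 (p z)) s, Derive (fun z => y1 (p z)) s,
   Derive (fun z => y2 (p z)) s).

(** * Surfaces and nets *)

Definition pd3 (i : idx) (r : R -> R -> A3) (x1 x2 : R) : A3 :=
  (pd i (fun a b => y0 (r a b)) x1 x2, pd i (fun a b => y1 (r a b)) x1 x2,
   pd i (fun a b => y2 (r a b)) x1 x2).

Definition regular_surface (D : R -> R -> Prop) (r : R -> R -> A3) : Prop :=
  forall x1 x2, D x1 x2 -> independent (pd3 I1 r x1 x2) (pd3 I2 r x1 x2).

Definition tangent_vector (r : R -> R -> A3) (x1 x2 : R) (v : A3) : Prop :=
  in_span v (pd3 I1 r x1 x2) (pd3 I2 r x1 x2).

Definition line_tangent_at (L : A3 -> Prop) (r : R -> R -> A3) (x1 x2 : R)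
    : Prop :=
  exists d, d <> zero3 /\ tangent_vector r x1 x2 d
            /\ forall y, L y <-> line (r x1 x2) d y.

(* A net is given by two transversal direction fields in the parameter domain;
   the coordinate net R^1, R^2 is the pair of fields (1,0), (0,1). *)
Definition net (D : R -> R -> Prop) (a b : idx -> R -> R -> R) : Prop :=
  (forall k, Cn_on 1 D (a k) /\ Cn_on 1 D (b k)) /\
  forall x1 x2, D x1 x2 ->
    a I1 x1 x2 * b I2 x1 x2 - a I2 x1 x2 * b I1 x1 x2 <> 0.

(* The derivative of r along a and then along b equals [hess r a b] up to a
   tangent vector, so that "lies in the tangent plane" may be tested on
   [hess r a b]. *)
Definition hess (r : R -> R -> A3) (a b : idx -> R -> R -> R) (x1 x2 : R)
    : A3 :=
  let row i := lin (b I1 x1 x2) (pd3 i (pd3 I1 r) x1 x2)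
                   (b I2 x1 x2) (pd3 i (pd3 I2 r) x1 x2) in
  lin (a I1 x1 x2) (row I1) (a I2 x1 x2) (row I2).

Definition conjugate_net (D : R -> R -> Prop) (r : R -> R -> A3)
    (a b : idx -> R -> R -> R) : Prop :=
  forall x1 x2, D x1 x2 -> tangent_vector r x1 x2 (hess r a b x1 x2).

Definition coord_field (i k : idx) (x1 x2 : R) : R :=
  match i, k with I1, I1 | I2, I2 => 1 | _, _ => 0 end.

Lemma conjugate_coordinate_net (D : R -> R -> Prop) (r : R -> R -> A3) :
  conjugate_net D r (coord_field I1) (coord_field I2) <->
  forall x1 x2, D x1 x2 -> tangent_vector r x1 x2 (pd3 I1 (pd3 I2 r) x1 x2).
Proof.
assert (E : forall x1 x2, hess r (coord_field I1) (coord_field I2) x1 x2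
                          = pd3 I1 (pd3 I2 r) x1 x2).
{ intros x1 x2; unfold hess, lin, coord_field, pd3, y0, y1, y2; simpl.
  f_equal; [f_equal|]; ring. }
unfold conjugate_net; split; intros H x1 x2 Hx; specialize (H x1 x2 Hx).
- now rewrite <- E.
- now rewrite E.
Qed.

(* Parametrizing by the whole line is no restriction: every open interval is
   diffeomorphic to it. *)
Definition regular_curve (D : R -> R -> Prop) (c : idx -> R -> R) : Prop :=
  forall s, (forall k, ex_derive (c k) s /\ continuous (Derive (c k)) s)
            /\ (Derive (c I1) s <> 0 \/ Derive (c I2) s <> 0)
            /\ D (c I1 s) (c I2 s).

Definition integral_curve (a : idx -> R -> R -> R) (c : idx -> R -> R) : Prop :=
  forall s, Derive (c I1) s * a I2 (c I1 s) (c I2 s)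
            - Derive (c I2) s * a I1 (c I1 s) (c I2 s) = 0.

Definition net_curve (a b : idx -> R -> R -> R) (c : idx -> R -> R) : Prop :=
  integral_curve a c \/ integral_curve b c.

(** * Ruled surfaces and congruences of lines *)

Definition ruled_by (L : R -> A3 -> Prop) (p d : R -> A3) : Prop :=
  forall s, ex_derive3 p s /\ ex_derive3 d s /\ d s <> zero3
            /\ forall y, L s y <-> line (p s) (d s) y.

(* The vanishing of this determinant does not depend on the choice of p, d. *)
Definition torsal (p d : R -> A3) (s : R) : Prop :=
  det3 (Derive3 p s) (d s) (Derive3 d s) = 0.

Definition developable (L : R -> A3 -> Prop) : Prop :=
  exists p d, ruled_by L p d /\ forall s, torsal p d s.

Definition along (L : R -> R -> A3 -> Prop) (c : idx -> R -> R)
    : R -> A3 -> Prop :=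
  fun s => L (c I1 s) (c I2 s).

(* Some ruled surface of the congruence L through the line L x1 x2 is not
   torsal there; then at most two directions at (x1, x2) are torsal. *)
Definition nondegenerate_at (D : R -> R -> Prop) (L : R -> R -> A3 -> Prop)
    (x1 x2 : R) : Prop :=
  exists c s p d, regular_curve D c /\ c I1 s = x1 /\ c I2 s = x2
    /\ ruled_by (along L c) p d /\ ~ torsal p d s.

(* The developable surfaces of L meet the surface r in the curves of a
   conjugate net. If every direction at a line is torsal (all ruled surfaces
   are developable when, say, all the lines pass through one point, as happens
   for q = a f + b u + c, a <> 0), then the developables do not single out a net;
   this is why the converse part is restricted to nondegenerate lines. *)
Definition congruence_conjugate (D : R -> R -> Prop)
    (L : R -> R -> A3 -> Prop) (r : R -> R -> A3) : Prop :=
  exists a b, net D a b /\ conjugate_net D r a b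
    /\ (forall x1 x2, D x1 x2 -> L x1 x2 (r x1 x2))
    /\ forall c, regular_curve D c ->
         (net_curve a b c -> developable (along L c))
         /\ ((forall s, nondegenerate_at D L (c I1 s) (c I2 s)) ->
             developable (along L c) -> net_curve a b c).

(** * The congruence l, the planes pi and their characteristics *)

(* From here on f and q are functions of (R^1, R^2). *)

Definition congr_l (u f : idx -> R -> R -> R) (x1 x2 : R) (y : A3) : Prop :=
  y1 y = u I1 x1 x2 * y0 y - f I1 x1 x2 /\
  y2 y = u I2 x1 x2 * y0 y - f I2 x1 x2.

(* A fraction (y^1 - u^1 y^0 + f^1)/q^1 = (y^2 - u^2 y^0 + f^2)/q^2 is a
   proportion, which makes sense as soon as one of q^1, q^2 is nonzero, hence
   the cross-multiplied equation. When both are nonzero, differentiating the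
   quotients instead gives the same intersection of pi with d_i pi: see
   [quotient_characteristic]. *)
Definition pi_eq (u f q : idx -> R -> R -> R) (y : A3) (x1 x2 : R) : R :=
  (y1 y - u I1 x1 x2 * y0 y + f I1 x1 x2) * q I2 x1 x2
  - (y2 y - u I2 x1 x2 * y0 y + f I2 x1 x2) * q I1 x1 x2.

Definition plane_pi (u f q : idx -> R -> R -> R) (x1 x2 : R) (y : A3) : Prop :=
  pi_eq u f q y x1 x2 = 0.

Definition plane_dpi (u f q : idx -> R -> R -> R) (i : idx) (x1 x2 : R)
    (y : A3) : Prop :=
  pd i (pi_eq u f q y) x1 x2 = 0.

Definition characteristic (u f q : idx -> R -> R -> R) (i : idx) (x1 x2 : R)
    (y : A3) : Prop :=
  plane_pi u f q x1 x2 y /\ plane_dpi u f q i x1 x2 y.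

Definition focal (u f lam : idx -> R -> R -> R) (i : idx) (x1 x2 : R) : A3 :=
  (lam i x1 x2, u I1 x1 x2 * lam i x1 x2 - f I1 x1 x2,
   u I2 x1 x2 * lam i x1 x2 - f I2 x1 x2).

Lemma quotient_characteristic (A B a b : R -> R) (t : R) :
  ex_derive A t -> ex_derive B t -> ex_derive a t -> ex_derive b t ->
  a t <> 0 -> b t <> 0 ->
  (A t / a t = B t / b t /\
   Derive (fun z => A z / a z) t = Derive (fun z => B z / b z) t)
  <-> (A t * b t - B t * a t = 0 /\
       Derive (fun z => A z * b z - B z * a z) t = 0).
Proof.
intros HA HB Ha Hb na nb.
rewrite !Derive_div by assumption.
rewrite Derive_minus by (apply @ex_derive_mult; assumption).
rewrite !Derive_mult by assumption.
generalize (Derive A t) (Derive B t) (Derive a t) (Derive b t).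
revert na nb; generalize (A t) (B t) (a t) (b t).
clear; intros A B a b na nb A' B' a' b'.
assert (K : A / a - B / b = (A * b - B * a) / (a * b)) by (field; tauto).
assert (K' : A * b - B * a = 0 ->
  (A' * a - A * a') / a ^ 2 - (B' * b - B * b') / b ^ 2
  = (A' * b + A * b' - (B' * a + B * a')) / (a * b)).
{ intros E; assert (EA : A = B * a / b) by (field_simplify_eq; lra).
  rewrite EA; field; tauto. }
assert (nab : a * b <> 0) by (apply Rmult_integral_contrapositive; tauto).
assert (Z : forall x, x / (a * b) = 0 -> x = 0).
{ intros x E; replace x with (x / (a * b) * (a * b)) by (field; tauto).
  rewrite E; ring. }
split; intros [E E'].
- assert (E0 : A * b - B * a = 0) by (apply Z; lra).
  split; [exact E0|]. apply Z. rewrite <- K' by exact E0. lra.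
- rewrite E in K. specialize (K' E). rewrite E' in K'.
  unfold Rdiv in K, K'. rewrite Rmult_0_l in K, K'. unfold Rdiv. lra.
Qed.

(* Main.v *)
Require Import Defs.
From Stdlib Require Import Reals Lra Lia.
From Coquelicot Require Import Coquelicot.
Open Scope R_scope.

(** Write F = f(u), Q = q(u) for the fluxes as functions of (R^1, R^2), d_j for
    the partial derivative with respect to R^j, let o be
    the index other than i, and put

      r_i = (lam_i, u lam_i - F),   e_i = (mu_i, u mu_i - Q),   T = (1, u).

    Here r_i is the focal surface of l, T directs l, and e_i is built from the
    commuting flow exactly as r_i is built from the system. The product rule and
    the diagonal form of the system give, for every index j,

      d_j r_i = (d_j lam_i) T + (lam_i - lam_j) (0, d_j u),

    and the same for e_i with mu instead of lam ([pd3_focal]). Everything follows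
    from this formula.

    The equations of pi and of its derivative with respect to R^i are solved
    explicitly: unless the second equation is a consequence of the first one, in
    which case their common solutions do not form a line ([wedge_neq_0]), the
    characteristic l_i is the line through r_i with direction e_i
    ([characteristic_line]). As Q is not zero, it meets l only in r_i.

    Taking j = i, d_i r_i is a multiple of T: this is the tangency of l, and
    differentiating once more in R^o shows that the coordinate net is conjugate
    on r_i ([focal_conjugate_net]).

    Let now c be a curve in the parameter domain. The derivatives of r_i and e_i
    along c are combinations of T and (0, d_o u), and the torsality determinant
    of the ruled surface (r_i, e_i) is a quadratic form in the velocity of c.
    Its coefficient at (c_i')^2 is zero because d_i r_i and d_i e_i are both
    multiples of T; its coefficient at (c_o')^2 is zero by the identity

      (d_o lam_i) (mu_i - mu_o) = (d_o mu_i) (lam_i - lam_o),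

    which comes from the equality of the mixed derivatives of F and of Q
    ([commuting_velocities]). What remains is c_1' c_2' times a function of the
    point ([torsal_along]). So the coordinate curves give developable surfaces,
    and on a curve of nondegenerate lines whose surface is developable
    c_1' c_2' = 0 everywhere; by continuity of the nonzero velocity one and the
    same factor vanishes identically ([coordinate_net_curve]). *)

(** * Partial derivatives *)

Definition other (i : idx) : idx := match i with I1 => I2 | I2 => I1 end.

(** The partial derivative of F in the i-th variable exists and equals l. *)
Definition is_pd (i : idx) (F : R -> R -> R) (x1 x2 l : R) : Prop :=
  match i with
  | I1 => is_derive (fun t => F t x2) x1 l
  | I2 => is_derive (fun t => F x1 t) x2 l
  end.

Lemma is_pd_unique i F x1 x2 l : is_pd i F x1 x2 l -> pd i F x1 x2 = l.
Proof. destruct i; apply is_derive_unique. Qed.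

Lemma is_pd_const i c x1 x2 : is_pd i (fun _ _ => c) x1 x2 0.
Proof. destruct i; exact (is_derive_const c _). Qed.

Lemma is_pd_plus i F G x1 x2 l m :
  is_pd i F x1 x2 l -> is_pd i G x1 x2 m ->
  is_pd i (fun a b => F a b + G a b) x1 x2 (l + m).
Proof. destruct i; intros HF HG; exact (is_derive_plus _ _ _ _ _ HF HG). Qed.

Lemma is_pd_minus i F G x1 x2 l m :
  is_pd i F x1 x2 l -> is_pd i G x1 x2 m ->
  is_pd i (fun a b => F a b - G a b) x1 x2 (l - m).
Proof. destruct i; intros HF HG; exact (is_derive_minus _ _ _ _ _ HF HG). Qed.

Lemma is_pd_mult i F G x1 x2 l m :
  is_pd i F x1 x2 l -> is_pd i G x1 x2 m ->
  is_pd i (fun a b => F a b * G a b) x1 x2 (l * G x1 x2 + F x1 x2 * m).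
Proof.
destruct i; intros HF HG; exact (is_derive_mult _ _ _ _ _ HF HG Rmult_comm).
Qed.

Lemma pd_ext (D : R -> R -> Prop) (D_open : open_2d D) i F G :
  (forall x1 x2, D x1 x2 -> F x1 x2 = G x1 x2) ->
  forall x1 x2, D x1 x2 -> pd i F x1 x2 = pd i G x1 x2.
Proof.
intros E x1 x2 Dx; destruct i; apply Derive_ext_loc.
- eapply filter_imp, (locally_2d_1d_const_y D), (D_open _ _ Dx).
  intros t; apply E.
- eapply filter_imp, (locally_2d_1d_const_x D), (D_open _ _ Dx).
  intros t; apply E.
Qed.

(** * Functions of class C^n *)

Lemma Cn_on_continuous n D F x1 x2 :
  Cn_on n D F -> D x1 x2 -> continuity_2d_pt F x1 x2.
Proof. intros CF Dx; specialize (CF _ _ Dx); destruct n; apply CF. Qed.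

Lemma Cn_on_is_pd n D F i x1 x2 :
  Cn_on (S n) D F -> D x1 x2 -> is_pd i F x1 x2 (pd i F x1 x2).
Proof.
intros CF Dx; destruct (CF _ _ Dx) as (_ & E1 & E2 & _).
destruct i; apply Derive_correct; assumption.
Qed.

Lemma Cn_on_pd n D F i : Cn_on (S n) D F -> Cn_on n D (pd i F).
Proof.
intros CF x1 x2 Dx; destruct (CF _ _ Dx) as (_ & _ & _ & C1 & C2).
destruct i; assumption.
Qed.

Lemma Cn_on_intro n D F :
  (forall x1 x2, D x1 x2 -> continuity_2d_pt F x1 x2) ->
  (forall i x1 x2, D x1 x2 -> exists l, is_pd i F x1 x2 l) ->
  (forall i, Cn_on n D (pd i F)) -> Cn_on (S n) D F.
Proof.
intros C E CD x1 x2 Dx; repeat split.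
- now apply C.
- exact (E I1 _ _ Dx).
- exact (E I2 _ _ Dx).
- exact (CD I1 _ _ Dx).
- exact (CD I2 _ _ Dx).
Qed.

Lemma Cn_on_weaken n m D F : (m <= n)%nat -> Cn_on n D F -> Cn_on m D F.
Proof. intros L C x1 x2 Dx; exact (ex_diff_n_m _ _ L _ _ _ (C _ _ Dx)). Qed.

Lemma Cn_on_ext n D F G : open_2d D ->
  (forall x1 x2, D x1 x2 -> F x1 x2 = G x1 x2) -> Cn_on n D F -> Cn_on n D G.
Proof.
intros OD E C x1 x2 Dx; apply (ex_diff_n_ext_loc F); [|now apply C].
apply locally_2d_impl with (2 := OD _ _ Dx).
apply locally_2d_forall; exact E.
Qed.

Lemma Cn_on_const n D c : Cn_on n D (fun _ _ => c).
Proof.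
intros x1 x2 _; revert c; induction n as [|n IH]; intros c.
{ split; [apply continuity_2d_pt_const | exact I]. }
split; [apply continuity_2d_pt_const|].
repeat split; try apply ex_derive_const.
- apply (ex_diff_n_ext_loc (fun _ _ => 0)); [|apply IH].
  apply locally_2d_forall; intros; symmetry; apply Derive_const.
- apply (ex_diff_n_ext_loc (fun _ _ => 0)); [|apply IH].
  apply locally_2d_forall; intros; symmetry; apply Derive_const.
Qed.

Lemma Cn_on_plus n D F G : open_2d D ->
  Cn_on n D F -> Cn_on n D G -> Cn_on n D (fun a b => F a b + G a b).
Proof.
intros OD; revert F G; induction n as [|n IH]; intros F G CF CG.
{ intros x1 x2 Dx; split; [|exact I].
  apply continuity_2d_pt_plus; eapply Cn_on_continuous; eassumption. }
assert (P : forall i x1 x2, D x1 x2 ->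
  is_pd i (fun a b => F a b + G a b) x1 x2 (pd i F x1 x2 + pd i G x1 x2)).
{ intros; apply is_pd_plus; eapply Cn_on_is_pd; eassumption. }
apply Cn_on_intro.
- intros; apply continuity_2d_pt_plus; eapply Cn_on_continuous; eassumption.
- intros; eexists; now apply P.
- intros i; apply (Cn_on_ext _ _ (fun a b => pd i F a b + pd i G a b) _ OD).
  + intros; symmetry; apply is_pd_unique; now apply P.
  + apply IH; now apply Cn_on_pd.
Qed.

Lemma Cn_on_mult n D F G : open_2d D ->
  Cn_on n D F -> Cn_on n D G -> Cn_on n D (fun a b => F a b * G a b).
Proof.
intros OD; revert F G; induction n as [|n IH]; intros F G CF CG.
{ intros x1 x2 Dx; split; [|exact I].
  apply continuity_2d_pt_mult; eapply Cn_on_continuous; eassumption. }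
assert (P : forall i x1 x2, D x1 x2 -> is_pd i (fun a b => F a b * G a b) x1 x2
              (pd i F x1 x2 * G x1 x2 + F x1 x2 * pd i G x1 x2)).
{ intros; apply is_pd_mult; eapply Cn_on_is_pd; eassumption. }
assert (L : (n <= S n)%nat) by lia.
apply Cn_on_intro.
- intros; apply continuity_2d_pt_mult; eapply Cn_on_continuous; eassumption.
- intros; eexists; now apply P.
- intros i; apply (Cn_on_ext _ _
    (fun a b => pd i F a b * G a b + F a b * pd i G a b) _ OD).
  + intros; symmetry; apply is_pd_unique; now apply P.
  + apply Cn_on_plus; [exact OD| |]; apply IH;
      solve [now apply Cn_on_pd | now apply (Cn_on_weaken (S n))].
Qed.

Lemma Cn_on_minus n D F G : open_2d D ->
  Cn_on n D F -> Cn_on n D G -> Cn_on n D (fun a b => F a b - G a b).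
Proof.
intros OD CF CG.
apply (Cn_on_ext _ _ (fun a b => F a b + (fun _ _ => -1) a b * G a b) _ OD).
- intros; ring.
- apply Cn_on_plus; [easy..|].
  apply Cn_on_mult; [easy| |easy]. apply Cn_on_const.
Qed.

(** A function of class C^1 is differentiable as a function of two variables. *)
Lemma Cn_on_differentiable D F x1 x2 : open_2d D -> Cn_on 1 D F -> D x1 x2 ->
  differentiable_pt_lim F x1 x2 (pd I1 F x1 x2) (pd I2 F x1 x2).
Proof.
intros OD CF Dx; apply filterdiff_differentiable_pt_lim.
apply (filterdiff_ext_lin _
  (fun w : R * R => plus (scal (fst w) (pd I1 F x1 x2))
                         (scal (snd w) (pd I2 F x1 x2)))); [|reflexivity].
apply (is_derive_filterdiff F x1 x2 (pd I1 F)).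
- apply (filter_imp (fun w => D (fst w) (snd w))).
  + intros [a b] Dab; exact (Cn_on_is_pd 0 D F I1 a b CF Dab).
  + apply locally_2d_locally, OD, Dx.
- exact (Cn_on_is_pd 0 D F I2 x1 x2 CF Dx).
- apply continuity_2d_pt_filterlim.
  apply (Cn_on_continuous 0 D); [now apply Cn_on_pd | exact Dx].
Qed.

Lemma pd_swap D F i x1 x2 : open_2d D -> Cn_on 2 D F -> D x1 x2 ->
  pd i (pd (other i) F) x1 x2 = pd (other i) (pd i F) x1 x2.
Proof.
intros OD CF Dx.
assert (S : pd I1 (pd I2 F) x1 x2 = pd I2 (pd I1 F) x1 x2).
{ apply Schwarz.
  - apply locally_2d_impl with (2 := OD _ _ Dx); apply locally_2d_forall.
    intros a b Dab; destruct (CF _ _ Dab) as (_ & E1 & E2 & C1 & C2).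
    repeat split; [exact E1 | exact E2 | apply C2 | apply C1].
  - exact (Cn_on_continuous 0 D _ _ _ (Cn_on_pd _ _ _ I1 (Cn_on_pd _ _ _ I2 CF)) Dx).
  - exact (Cn_on_continuous 0 D _ _ _ (Cn_on_pd _ _ _ I2 (Cn_on_pd _ _ _ I1 CF)) Dx). }
destruct i; [exact S | symmetry; exact S].
Qed.

(** The chain rule along a plane curve. *)
Lemma is_derive_along D F (c : idx -> R -> R) s :
  open_2d D -> Cn_on 1 D F -> D (c I1 s) (c I2 s) ->
  (forall k, ex_derive (c k) s) ->
  is_derive (fun t => F (c I1 t) (c I2 t)) s
    (sum_idx (fun j => Derive (c j) s * pd j F (c I1 s) (c I2 s))).
Proof.
intros OD CF Dc Ec; apply is_derive_Reals.
unfold sum_idx; rewrite !(Rmult_comm (Derive _ _)).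
apply derivable_pt_lim_comp_2d.
- now apply (Cn_on_differentiable D).
- apply is_derive_Reals, Derive_correct, Ec.
- apply is_derive_Reals, Derive_correct, Ec.
Qed.

Lemma differentiable_pull D V u F x1 x2 : open_2d D -> open_2d V ->
  (forall a b, D a b -> V (u I1 a b) (u I2 a b)) ->
  (forall k, Cn_on 1 D (u k)) -> Cn_on 1 V F -> D x1 x2 ->
  differentiable_pt (pull u F) x1 x2.
Proof.
intros OD OV uV Cu CF Dx; do 2 eexists.
apply (differentiable_pt_lim_comp F (u I1) (u I2)).
- apply (Cn_on_differentiable V); auto.
- apply (Cn_on_differentiable D); auto.
- apply (Cn_on_differentiable D); auto.
Qed.

(** A flux is of class C^2 in the Riemann invariants: its partial derivatives
    v^i d_i u^k are visibly of class C^1, so that the second derivatives of a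
    composite function are not needed. *)
Lemma Cn_on_pull_flux D V u g v k : open_2d D -> open_2d V ->
  (forall a b, D a b -> V (u I1 a b) (u I2 a b)) ->
  (forall k, Cn_on 2 D (u k)) -> (forall i, Cn_on 1 D (v i)) ->
  (forall k, Cn_on 1 V (g k)) ->
  diagonal_form D u g v -> Cn_on 2 D (pull u (g k)).
Proof.
intros OD OV uV Cu Cv Cg diag.
assert (Cu1 : forall k, Cn_on 1 D (u k)).
{ intros k'; now apply (Cn_on_weaken 2); [lia|]. }
apply Cn_on_intro.
- intros x1 x2 Dx; apply differentiable_continuity_pt.
  now apply (differentiable_pull D V).
- intros i x1 x2 Dx.
  destruct i.
  + eexists; apply (is_derive_along V (g k) (fun k t => u k t x2)); auto.
    intros k'; eexists; apply (Cn_on_is_pd 0 D (u k') I1 x1 x2); auto.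
  + eexists; apply (is_derive_along V (g k) (fun k t => u k x1 t)); auto.
    intros k'; eexists; apply (Cn_on_is_pd 0 D (u k') I2 x1 x2); auto.
- intros i; apply (Cn_on_ext _ _ (fun a b => v i a b * pd i (u k) a b) _ OD).
  + intros; symmetry; now apply diag.
  + apply Cn_on_mult; auto. now apply Cn_on_pd.
Qed.

(** * Vectors in A^3 *)

Lemma A3_ext a b : y0 a = y0 b -> y1 a = y1 b -> y2 a = y2 b -> a = b.
Proof.
destruct a as [[a0 a1] a2], b as [[b0 b1] b2]; unfold y0, y1, y2; simpl.
congruence.
Qed.

Lemma lin_comm s a t b : lin s a t b = lin t b s a.
Proof. apply A3_ext; cbn; ring. Qed.

Lemma in_span_sym v a b : in_span v a b -> in_span v b a.
Proof. intros (s & t & E); exists t, s; now rewrite lin_comm. Qed.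

Lemma tangent_vector_idx i r x1 x2 v :
  tangent_vector r x1 x2 v <->
  in_span v (pd3 i r x1 x2) (pd3 (other i) r x1 x2).
Proof. destruct i; [reflexivity | split; apply in_span_sym]. Qed.

(** Two parametrizations of one line differ by a shift of the base point along
    the line and a nonzero rescaling of the direction. *)
Lemma line_generators p d p' d' : d <> zero3 ->
  (forall y, line p d y <-> line p' d' y) ->
  (exists m, p = lin 1 p' m d') /\ (exists m, m <> 0 /\ d = lin 0 zero3 m d').
Proof.
intros d_nz E.
assert (P : line p d p) by (exists 0; apply A3_ext; cbn; ring).
assert (Q : line p d (lin 1 p 1 d)) by now exists 1.
apply E in P, Q; destruct P as [m Em], Q as [m' Em'].
split; [now exists m|].
assert (Ed : d = lin 0 zero3 (m' - m) d').
{ assert (E0 := f_equal y0 Em); assert (E1 := f_equal y1 Em).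
  assert (E2 := f_equal y2 Em); assert (F0 := f_equal y0 Em').
  assert (F1 := f_equal y1 Em'); assert (F2 := f_equal y2 Em').
  apply A3_ext; cbn in *; lra. }
exists (m' - m); split; [|exact Ed].
intros Z; apply d_nz; rewrite Ed, Z; apply A3_ext; cbn; ring.
Qed.

(** The scalar product of the coordinate space. It serves to extract the
    coefficients of collinear vectors as differentiable functions. *)
Definition dot (a b : A3) : R := y0 a * y0 b + y1 a * y1 b + y2 a * y2 b.

Lemma dot_self_nz a : a <> zero3 -> dot a a <> 0.
Proof.
intros a_nz Z; apply a_nz; unfold dot in Z; apply A3_ext; cbn; nra.
Qed.

Lemma ex_derive_dot p q s : ex_derive3 p s -> ex_derive3 q s ->
  ex_derive (fun t => dot (p t) (q t)) s.
Proof.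
intros (P0 & P1 & P2) (Q0 & Q1 & Q2); unfold dot.
apply @ex_derive_plus; [apply @ex_derive_plus|]; apply @ex_derive_mult; assumption.
Qed.

Lemma ex_derive3_lin g p h q s : ex_derive g s -> ex_derive h s ->
  ex_derive3 p s -> ex_derive3 q s ->
  ex_derive3 (fun t => lin (g t) (p t) (h t) (q t)) s.
Proof.
intros G H (P0 & P1 & P2) (Q0 & Q1 & Q2).
repeat split; cbn; apply @ex_derive_plus; apply @ex_derive_mult; assumption.
Qed.

Lemma Derive3_lin g p h q s : ex_derive g s -> ex_derive h s ->
  ex_derive3 p s -> ex_derive3 q s ->
  Derive3 (fun t => lin (g t) (p t) (h t) (q t)) s
  = lin 1 (lin (Derive g s) (p s) (g s) (Derive3 p s))
        1 (lin (Derive h s) (q s) (h s) (Derive3 q s)).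
Proof.
intros G H (P0 & P1 & P2) (Q0 & Q1 & Q2).
apply A3_ext; cbn;
  rewrite Derive_plus by (apply @ex_derive_mult; assumption);
  rewrite !Derive_mult by assumption; ring.
Qed.

Lemma Derive3_ext p q s : (forall t, p t = q t) -> Derive3 p s = Derive3 q s.
Proof.
intros E; apply A3_ext; cbn; apply Derive_ext; intros t; now rewrite E.
Qed.

(** Torsality does not depend on the parametrization of the ruled surface: with
    p = p' + al d' and d = be d', the determinant is multiplied by be^2. *)
Lemma torsal_change_of_generators L p d p' d' s :
  ruled_by L p d -> ruled_by L p' d' -> torsal p d s -> torsal p' d' s.
Proof.
intros H H' T.
assert (Ep : forall t, p t = lin 1 (p' t)
  (dot (lin 1 (p t) (-1) (p' t)) (d' t) / dot (d' t) (d' t)) (d' t)).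
{ intros t; destruct (H t) as (_ & _ & nz & E), (H' t) as (_ & _ & nz' & E').
  destruct (line_generators (p t) (d t) (p' t) (d' t) nz) as [[m Em] _].
  { intros y; rewrite <- E; apply E'. }
  assert (N := dot_self_nz _ nz').
  rewrite Em at 1; f_equal; rewrite Em.
  field_simplify_eq; [|exact N]; unfold dot; cbn; ring. }
assert (Ed : forall t, dot (d t) (d' t) / dot (d' t) (d' t) <> 0 /\
  d t = lin 0 zero3 (dot (d t) (d' t) / dot (d' t) (d' t)) (d' t)).
{ intros t; destruct (H t) as (_ & _ & nz & E), (H' t) as (_ & _ & nz' & E').
  destruct (line_generators (p t) (d t) (p' t) (d' t) nz) as [_ (m & m_nz & Em)].
  { intros y; rewrite <- E; apply E'. }
  assert (N := dot_self_nz _ nz').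
  replace (dot (d t) (d' t) / dot (d' t) (d' t)) with m; [now split|].
  rewrite Em; field_simplify_eq; [|exact N]; unfold dot; cbn; ring. }
destruct (H s) as (Dp & Dd & _), (H' s) as (Dp' & Dd' & nz' & _).
set (al := fun t => dot (lin 1 (p t) (-1) (p' t)) (d' t) / dot (d' t) (d' t)).
set (be := fun t => dot (d t) (d' t) / dot (d' t) (d' t)).
assert (N := dot_self_nz _ nz').
assert (Dal : ex_derive al s).
{ apply ex_derive_div; [|now apply ex_derive_dot|exact N].
  apply (ex_derive_dot (fun t => lin 1 (p t) (-1) (p' t))); [|exact Dd'].
  apply (ex_derive3_lin (fun _ => 1) p (fun _ => -1) p');
    try apply ex_derive_const; assumption. }
assert (Dbe : ex_derive be s).
{ apply ex_derive_div; [..|exact N]; now apply ex_derive_dot. }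
unfold torsal in T |- *.
rewrite (Derive3_ext p (fun t => lin ((fun _ => 1) t) (p' t) (al t) (d' t)) s Ep) in T.
rewrite (Derive3_ext d (fun t => lin ((fun _ => 0) t) ((fun _ => zero3) t)
           (be t) (d' t)) s (fun t => proj2 (Ed t))) in T.
destruct (Ed s) as [be_nz Eds]; fold (be s) in be_nz, Eds.
assert (D0 : ex_derive3 (fun _ => zero3) s).
{ repeat split; apply ex_derive_const. }
rewrite Eds, Derive3_lin, Derive3_lin, !Derive_const in T
  by (assumption || apply ex_derive_const).
assert (Z : Derive3 (fun _ => zero3) s = zero3).
{ apply A3_ext; cbn; apply Derive_const. }
rewrite Z in T.
assert (K : (be s * be s) * det3 (Derive3 p' s) (d' s) (Derive3 d' s) = 0).
{ rewrite <- T; generalize (Derive3 p' s) (Derive3 d' s); intros a b.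
  unfold det3; cbn; ring. }
apply Rmult_integral in K; destruct K as [K|K]; [|exact K].
now destruct (Rmult_integral_contrapositive_currified _ _ be_nz be_nz).
Qed.

(** * Surfaces of class C^n *)

(** A surface of class C^n: each of its three coordinates is. *)
Definition Cn_on3 (n : nat) (D : R -> R -> Prop) (r : R -> R -> A3) : Prop :=
  Cn_on n D (fun a b => y0 (r a b)) /\ Cn_on n D (fun a b => y1 (r a b)) /\
  Cn_on n D (fun a b => y2 (r a b)).

Lemma pd3_swap D r i x1 x2 : open_2d D -> Cn_on3 2 D r -> D x1 x2 ->
  pd3 i (pd3 (other i) r) x1 x2 = pd3 (other i) (pd3 i r) x1 x2.
Proof.
intros OD (C0 & C1 & C2) Dx.
apply A3_ext; [apply (pd_swap D _ i _ _ OD C0 Dx)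
  | apply (pd_swap D _ i _ _ OD C1 Dx) | apply (pd_swap D _ i _ _ OD C2 Dx)].
Qed.

Lemma pd3_ext (D : R -> R -> Prop) (OD : open_2d D) i r r' :
  (forall x1 x2, D x1 x2 -> r x1 x2 = r' x1 x2) ->
  forall x1 x2, D x1 x2 -> pd3 i r x1 x2 = pd3 i r' x1 x2.
Proof.
intros E x1 x2 Dx; apply A3_ext; cbn; apply (pd_ext D OD); auto;
  intros; now rewrite E.
Qed.

Lemma Derive3_along D r (c : idx -> R -> R) s i :
  open_2d D -> Cn_on3 1 D r -> D (c I1 s) (c I2 s) ->
  (forall k, ex_derive (c k) s) ->
  ex_derive3 (fun t => r (c I1 t) (c I2 t)) s /\
  Derive3 (fun t => r (c I1 t) (c I2 t)) s
  = lin (Derive (c i) s) (pd3 i r (c I1 s) (c I2 s))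
        (Derive (c (other i)) s) (pd3 (other i) r (c I1 s) (c I2 s)).
Proof.
intros OD (C0 & C1 & C2) Dc Ec.
assert (A0 := is_derive_along D _ c s OD C0 Dc Ec).
assert (A1 := is_derive_along D _ c s OD C1 Dc Ec).
assert (A2 := is_derive_along D _ c s OD C2 Dc Ec).
split; [repeat split; eexists; eassumption|].
transitivity (lin (Derive (c I1) s) (pd3 I1 r (c I1 s) (c I2 s))
                  (Derive (c I2) s) (pd3 I2 r (c I1 s) (c I2 s))).
- apply A3_ext; apply is_derive_unique; assumption.
- destruct i; [reflexivity | apply lin_comm].
Qed.

(** * Focal surfaces *)

(** The system with densities u and fluxes F, both given as functions of the
    Riemann invariants, has characteristic velocities v. Here u, F and v are of
    class C^2. *)
Record diagonal_flux (D : R -> R -> Prop) (u F v : idx -> R -> R -> R) : Prop := {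
  flux_density : forall k, Cn_on 2 D (u k);
  flux_C2 : forall k, Cn_on 2 D (F k);
  flux_velocity : forall i, Cn_on 2 D (v i);
  flux_pd : forall i k x1 x2, D x1 x2 ->
    pd i (F k) x1 x2 = v i x1 x2 * pd i (u k) x1 x2 }.

(** The direction of the line l. *)
Definition l_dir (u : idx -> R -> R -> R) (x1 x2 : R) : A3 :=
  (1, u I1 x1 x2, u I2 x1 x2).

(** The vector (0, d_j u^1, d_j u^2). *)
Definition du (u : idx -> R -> R -> R) (j : idx) (x1 x2 : R) : A3 :=
  (0, pd j (u I1) x1 x2, pd j (u I2) x1 x2).

Lemma focal_C2 D u F v i : open_2d D -> diagonal_flux D u F v ->
  Cn_on3 2 D (focal u F v i).
Proof.
intros OD [Cu CF Cv _]; split; [exact (Cv i)|split]; cbn;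
  apply Cn_on_minus; auto; now apply Cn_on_mult.
Qed.

Lemma Cn_on3_weaken n m D r : (m <= n)%nat -> Cn_on3 n D r -> Cn_on3 m D r.
Proof.
intros L (C0 & C1 & C2); split; [|split]; eapply Cn_on_weaken; eassumption.
Qed.

Lemma pd3_focal D u F v i j x1 x2 : diagonal_flux D u F v -> D x1 x2 ->
  pd3 j (focal u F v i) x1 x2
  = lin (pd j (v i) x1 x2) (l_dir u x1 x2)
        (v i x1 x2 - v j x1 x2) (du u j x1 x2).
Proof.
intros [Cu CF Cv E] Dx.
assert (K : forall k, pd j (fun a b => u k a b * v i a b - F k a b) x1 x2
  = pd j (v i) x1 x2 * u k x1 x2 +
    (v i x1 x2 - v j x1 x2) * pd j (u k) x1 x2).
{ intros k; erewrite is_pd_unique;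
    [|apply is_pd_minus; [apply is_pd_mult|]; eapply Cn_on_is_pd; eauto].
  rewrite E by exact Dx; ring. }
apply A3_ext; [|etransitivity; [apply K | cbn; ring]..].
cbn; change (pd j (fun a b => v i a b) x1 x2) with (pd j (v i) x1 x2); ring.
Qed.

(** * Velocities of commuting flows *)

(** The equality of the mixed derivatives of the flux F^k. *)
Lemma pd_velocity_relation D u F v i k x1 x2 :
  open_2d D -> diagonal_flux D u F v -> D x1 x2 ->
  let o := other i in
  (v i x1 x2 - v o x1 x2) * pd o (pd i (u k)) x1 x2
  = pd i (v o) x1 x2 * pd o (u k) x1 x2 - pd o (v i) x1 x2 * pd i (u k) x1 x2.
Proof.
intros OD [Cu CF Cv E] Dx o.
assert (S := pd_swap D (F k) i x1 x2 OD (CF k) Dx); fold o in S.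
rewrite (pd_ext D OD i _ _ (E o k) x1 x2 Dx) in S.
rewrite (pd_ext D OD o _ _ (E i k) x1 x2 Dx) in S.
assert (P : forall a b, pd a (fun x1 x2 => v b x1 x2 * pd b (u k) x1 x2) x1 x2
  = pd a (v b) x1 x2 * pd b (u k) x1 x2
    + v b x1 x2 * pd a (pd b (u k)) x1 x2).
{ intros a b; apply is_pd_unique, is_pd_mult;
    eapply Cn_on_is_pd; eauto using Cn_on_pd. }
assert (S' := pd_swap D (u k) i x1 x2 OD (Cu k) Dx); fold o in S'.
rewrite !P, S' in S; lra.
Qed.

(** The vectors d_1 u and d_2 u are linearly independent, as (R^1, R^2) are
    coordinates. *)
Lemma du_independent D u i x1 x2 s t : coordinates D u -> D x1 x2 ->
  (forall k, s * pd i (u k) x1 x2 + t * pd (other i) (u k) x1 x2 = 0) ->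
  s = 0 /\ t = 0.
Proof.
intros Cu Dx E; specialize (Cu _ _ Dx).
assert (E1 := E I1); assert (E2 := E I2); clear E.
destruct i; cbn [other] in E1, E2; split; eapply Rmult_eq_reg_r; try exact Cu.
- transitivity (pd I2 (u I2) x1 x2 * 0 - pd I2 (u I1) x1 x2 * 0); [|ring].
  rewrite <- E1 at 1; rewrite <- E2; ring.
- transitivity (pd I1 (u I1) x1 x2 * 0 - pd I1 (u I2) x1 x2 * 0); [|ring].
  rewrite <- E2 at 1; rewrite <- E1; ring.
- transitivity (pd I1 (u I1) x1 x2 * 0 - pd I1 (u I2) x1 x2 * 0); [|ring].
  rewrite <- E2 at 1; rewrite <- E1; ring.
- transitivity (pd I2 (u I2) x1 x2 * 0 - pd I2 (u I1) x1 x2 * 0); [|ring].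
  rewrite <- E1 at 1; rewrite <- E2; ring.
Qed.

(** Both systems have the same mixed derivatives d_1 d_2 u^k; eliminating these
    leaves a relation between d_1 u and d_2 u, whose coefficients must vanish. *)
Lemma commuting_velocities D u F lam Q mu i x1 x2 : open_2d D ->
  diagonal_flux D u F lam -> diagonal_flux D u Q mu -> coordinates D u ->
  D x1 x2 ->
  pd (other i) (lam i) x1 x2 * (mu i x1 x2 - mu (other i) x1 x2)
  = pd (other i) (mu i) x1 x2 * (lam i x1 x2 - lam (other i) x1 x2).
Proof.
intros OD HF HQ Cu Dx.
set (o := other i).
apply Rminus_diag_uniq.
apply (du_independent D u i x1 x2 _
  (pd i (mu o) x1 x2 * (lam i x1 x2 - lam o x1 x2)
   - pd i (lam o) x1 x2 * (mu i x1 x2 - mu o x1 x2)) Cu Dx).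
intros k; fold o.
assert (A := pd_velocity_relation D u F lam i k x1 x2 OD HF Dx).
assert (B := pd_velocity_relation D u Q mu i k x1 x2 OD HQ Dx).
cbv zeta in A, B; fold o in A, B.
transitivity ((lam i x1 x2 - lam o x1 x2)
    * ((mu i x1 x2 - mu o x1 x2) * pd o (pd i (u k)) x1 x2)
  - (mu i x1 x2 - mu o x1 x2)
    * ((lam i x1 x2 - lam o x1 x2) * pd o (pd i (u k)) x1 x2)); [|ring].
rewrite A, B; ring.
Qed.

(** * The characteristics of the planes *)

Lemma congr_l_focal u F v i x1 x2 y :
  congr_l u F x1 x2 y <-> line (focal u F v i x1 x2) (l_dir u x1 x2) y.
Proof.
split.
- intros [E1 E2]; exists (y0 y - v i x1 x2); apply A3_ext; cbn; lra.
- intros [t ->]; split; cbn; ring.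
Qed.

Lemma congr_l_in_plane u F Q x1 x2 y :
  congr_l u F x1 x2 y -> plane_pi u F Q x1 x2 y.
Proof. intros [E1 E2]; unfold plane_pi, pi_eq; rewrite E1, E2; ring. Qed.

(** The amount by which the point y fails the k-th equation of l; it is the
    numerator of the k-th fraction in the equation of pi. *)
Definition excess (u F : idx -> R -> R -> R) (x1 x2 : R) (y : A3) (k : idx) : R :=
  match k with I1 => y1 y | I2 => y2 y end - u k x1 x2 * y0 y + F k x1 x2.

(** The determinant of d_i u and Q. *)
Definition wedge (u Q : idx -> R -> R -> R) (i : idx) (x1 x2 : R) : R :=
  pd i (u I1) x1 x2 * Q I2 x1 x2 - pd i (u I2) x1 x2 * Q I1 x1 x2.

Lemma pd_pi_eq D u F lam Q mu i x1 x2 y :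
  diagonal_flux D u F lam -> diagonal_flux D u Q mu -> D x1 x2 ->
  pd i (pi_eq u F Q y) x1 x2
  = (lam i x1 x2 - y0 y) * wedge u Q i x1 x2
    + mu i x1 x2 * (excess u F x1 x2 y I1 * pd i (u I2) x1 x2
                    - excess u F x1 x2 y I2 * pd i (u I1) x1 x2).
Proof.
intros [Cu CF _ EF] [_ CQ _ EQ] Dx.
assert (PF : forall k, is_pd i (F k) x1 x2 (pd i (F k) x1 x2)).
{ intros k; exact (Cn_on_is_pd 1 D (F k) i x1 x2 (CF k) Dx). }
assert (PQ : forall k, is_pd i (Q k) x1 x2 (pd i (Q k) x1 x2)).
{ intros k; exact (Cn_on_is_pd 1 D (Q k) i x1 x2 (CQ k) Dx). }
assert (P : forall e k, is_pd i (fun a b => e - u k a b * y0 y + F k a b) x1 x2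
  (0 - (pd i (u k) x1 x2 * y0 y + u k x1 x2 * 0) + pd i (F k) x1 x2)).
{ intros e k.
  apply (is_pd_plus i (fun a b => e - u k a b * y0 y) (F k)); [|apply PF].
  apply (is_pd_minus i (fun _ _ => e) (fun a b => u k a b * y0 y));
    [apply is_pd_const|].
  apply (is_pd_mult i (u k) (fun _ _ => y0 y)); [|apply is_pd_const].
  exact (Cn_on_is_pd 1 D (u k) i x1 x2 (Cu k) Dx). }
assert (H := is_pd_unique _ _ _ _ _ (is_pd_minus _ _ _ _ _ _ _
  (is_pd_mult _ _ _ _ _ _ _ (P (y1 y) I1) (PQ I2))
  (is_pd_mult _ _ _ _ _ _ _ (P (y2 y) I2) (PQ I1)))).
etransitivity; [exact H|].
rewrite !EF, !EQ by exact Dx; unfold wedge, excess; ring.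
Qed.

Lemma proportional a1 a2 b1 b2 : b1 <> 0 \/ b2 <> 0 -> a1 * b2 - a2 * b1 = 0 ->
  exists s, a1 = s * b1 /\ a2 = s * b2.
Proof.
intros [N|N] E.
- exists (a1 / b1); split; field_simplify_eq; lra.
- exists (a2 / b2); split; field_simplify_eq; lra.
Qed.

(** If d_i u and Q were proportional, the two equations of the characteristic
    would define the whole plane pi, which is not a line. *)
Lemma wedge_neq_0 D u F lam Q mu i x1 x2 :
  diagonal_flux D u F lam -> diagonal_flux D u Q mu -> D x1 x2 ->
  (Q I1 x1 x2 <> 0 \/ Q I2 x1 x2 <> 0) ->
  is_line (characteristic u F Q i x1 x2) -> wedge u Q i x1 x2 <> 0.
Proof.
intros HF HQ Dx NQ (p & d & _ & E) W.
assert (Pl : forall y, plane_pi u F Q x1 x2 y -> line p d y).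
{ intros y Py; apply E; split; [exact Py|]; unfold plane_dpi.
  rewrite (pd_pi_eq D u F lam Q mu) by assumption; rewrite W.
  destruct (proportional (excess u F x1 x2 y I1) (excess u F x1 x2 y I2)
              _ _ NQ Py) as (s & -> & ->).
  transitivity (- mu i x1 x2 * s * wedge u Q i x1 x2);
    [unfold wedge | rewrite W]; ring. }
(* three points of pi that are not collinear *)
set (r := focal u F lam i x1 x2).
destruct (Pl r) as [t0 E0].
{ unfold plane_pi, pi_eq, r; cbn; ring. }
destruct (Pl (lin 1 r 1 (l_dir u x1 x2))) as [t1 E1].
{ unfold plane_pi, pi_eq, r; cbn; ring. }
destruct (Pl (lin 1 r 1 (0, Q I1 x1 x2, Q I2 x1 x2))) as [t2 E2].
{ unfold plane_pi, pi_eq, r; cbn; ring. }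
assert (A0 := f_equal y0 E0); assert (A1 := f_equal y1 E0).
assert (A2 := f_equal y2 E0); assert (B0 := f_equal y0 E1).
assert (C0 := f_equal y0 E2); assert (C1 := f_equal y1 E2).
assert (C2 := f_equal y2 E2); clear E0 E1 E2.
cbn -[r] in *.
assert (d0 : y0 d <> 0) by (intros Z; rewrite Z in *; lra).
assert (T : t2 = t0).
{ apply (Rmult_eq_reg_r (y0 d)); lra. }
subst t2; destruct NQ as [N|N]; apply N; lra.
Qed.

Lemma characteristic_line D u F lam Q mu i x1 x2 y :
  diagonal_flux D u F lam -> diagonal_flux D u Q mu -> D x1 x2 ->
  (Q I1 x1 x2 <> 0 \/ Q I2 x1 x2 <> 0) -> wedge u Q i x1 x2 <> 0 ->
  characteristic u F Q i x1 x2 y <->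
  line (focal u F lam i x1 x2) (focal u Q mu i x1 x2) y.
Proof.
intros HF HQ Dx NQ W; unfold characteristic, plane_dpi.
rewrite (pd_pi_eq D u F lam Q mu) by assumption.
split.
- intros [Py Dy].
  destruct (proportional (excess u F x1 x2 y I1) (excess u F x1 x2 y I2)
              _ _ NQ Py) as (s & E1 & E2).
  rewrite E1, E2 in Dy.
  assert (Y : y0 y = lam i x1 x2 - s * mu i x1 x2).
  { apply (Rmult_eq_reg_r (wedge u Q i x1 x2)); [|exact W].
    apply Rminus_diag_uniq_sym; rewrite <- Dy; unfold wedge; ring. }
  unfold excess in E1, E2.
  exists (- s); apply A3_ext; cbn.
  + rewrite Y; ring.
  + replace (y1 y) with (u I1 x1 x2 * y0 y - F I1 x1 x2 + s * Q I1 x1 x2)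
      by lra; rewrite Y; ring.
  + replace (y2 y) with (u I2 x1 x2 * y0 y - F I2 x1 x2 + s * Q I2 x1 x2)
      by lra; rewrite Y; ring.
- intros [t ->]; unfold plane_pi, pi_eq, excess, wedge; split; cbn; ring.
Qed.

Lemma focal_neq_0 u Q mu i x1 x2 : Q I1 x1 x2 <> 0 \/ Q I2 x1 x2 <> 0 ->
  focal u Q mu i x1 x2 <> zero3.
Proof.
intros NQ E; assert (E0 := f_equal y0 E); assert (E1 := f_equal y1 E).
assert (E2 := f_equal y2 E); cbn in *; rewrite E0 in *.
destruct NQ as [N|N]; apply N; lra.
Qed.

Lemma characteristic_meets_l u F lam Q mu i x1 x2 y :
  Q I1 x1 x2 <> 0 \/ Q I2 x1 x2 <> 0 ->
  line (focal u F lam i x1 x2) (focal u Q mu i x1 x2) y /\ congr_l u F x1 x2 y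
  <-> y = focal u F lam i x1 x2.
Proof.
intros NQ; split.
- intros [[t ->] [E1 E2]]; cbn in E1, E2.
  assert (T1 : t * Q I1 x1 x2 = 0) by lra.
  assert (T2 : t * Q I2 x1 x2 = 0) by lra.
  assert (t = 0) as ->.
  { destruct NQ as [N|N]; [apply Rmult_integral in T1 | apply Rmult_integral in T2];
      tauto. }
  apply A3_ext; cbn; ring.
- intros ->; split; [exists 0; apply A3_ext; cbn; ring | split; cbn; ring].
Qed.

(** * Tangency and the conjugate net *)

(** Otherwise the i-th partial derivative of the focal surface would vanish. *)
Lemma focal_pd_neq_0 D u F v i x1 x2 : diagonal_flux D u F v ->
  regular_surface D (focal u F v i) -> D x1 x2 -> pd i (v i) x1 x2 <> 0.
Proof.
intros HF reg Dx Z.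
assert (P : pd3 i (focal u F v i) x1 x2 = zero3).
{ rewrite (pd3_focal D) by assumption; rewrite Z; apply A3_ext; cbn; ring. }
specialize (reg _ _ Dx); destruct i.
- destruct (reg 1 0) as [K _]; [rewrite P; apply A3_ext; cbn; ring | lra].
- destruct (reg 0 1) as [_ K]; [rewrite P; apply A3_ext; cbn; ring | lra].
Qed.

Lemma l_tangent_focal D u F v i x1 x2 : diagonal_flux D u F v ->
  regular_surface D (focal u F v i) -> D x1 x2 ->
  line_tangent_at (congr_l u F x1 x2) (focal u F v i) x1 x2.
Proof.
intros HF reg Dx; exists (l_dir u x1 x2); split; [|split].
- intros E; apply (f_equal y0) in E; cbn in E; lra.
- apply (tangent_vector_idx i); exists (/ pd i (v i) x1 x2), 0.
  assert (N := focal_pd_neq_0 D u F v i x1 x2 HF reg Dx).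
  rewrite (pd3_focal D u F v i i) by assumption.
  apply A3_ext; cbn; field; exact N.
- apply congr_l_focal.
Qed.

Lemma focal_conjugate_net D u F v i : open_2d D -> diagonal_flux D u F v ->
  strictly_hyperbolic D v -> regular_surface D (focal u F v i) ->
  conjugate_net D (focal u F v i) (coord_field I1) (coord_field I2).
Proof.
intros OD HF hyp reg; apply conjugate_coordinate_net; intros x1 x2 Dx.
assert (C := focal_C2 D u F v i OD HF).
apply (tangent_vector_idx i).
assert (S : pd3 I1 (pd3 I2 (focal u F v i)) x1 x2
            = pd3 (other i) (pd3 i (focal u F v i)) x1 x2).
{ destruct i; [apply (pd3_swap D _ I1 x1 x2 OD C Dx) | reflexivity]. }
set (o := other i) in *.
assert (N := focal_pd_neq_0 D u F v i x1 x2 HF reg Dx).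
assert (H : v i x1 x2 - v o x1 x2 <> 0).
{ specialize (hyp _ _ Dx); unfold o; destruct i; cbn; lra. }
assert (E : pd3 o (pd3 i (focal u F v i)) x1 x2
  = lin (pd o (pd i (v i)) x1 x2) (l_dir u x1 x2)
        (pd i (v i) x1 x2) (du u o x1 x2)).
{ rewrite (pd3_ext D OD o _ (fun a b => (pd i (v i) a b,
    pd i (v i) a b * u I1 a b, pd i (v i) a b * u I2 a b))).
  - destruct HF as [Cu _ Cv _].
    assert (P : forall k, pd o (fun a b => pd i (v i) a b * u k a b) x1 x2
      = pd o (pd i (v i)) x1 x2 * u k x1 x2
        + pd i (v i) x1 x2 * pd o (u k) x1 x2).
    { intros k; apply is_pd_unique, is_pd_mult;
        eapply Cn_on_is_pd; eauto using Cn_on_pd. }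
    apply A3_ext; [|etransitivity; [apply P | cbn; ring]..].
    cbn; change (pd o (fun a b => pd i (v i) a b) x1 x2)
      with (pd o (pd i (v i)) x1 x2); ring.
  - intros a b Dab; rewrite (pd3_focal D) by assumption.
    apply A3_ext; cbn; ring.
  - exact Dx. }
(* T and (0, d_o u) are expressed by the tangent vectors d_i r and d_o r *)
rewrite S, E, !(pd3_focal D) by assumption.
exists ((pd o (pd i (v i)) x1 x2
         - pd i (v i) x1 x2 * pd o (v i) x1 x2 / (v i x1 x2 - v o x1 x2))
        / pd i (v i) x1 x2), (pd i (v i) x1 x2 / (v i x1 x2 - v o x1 x2)).
apply A3_ext; cbn; field; auto.
Qed.

(** * The developable surfaces of the characteristics *)

(** The factor which, multiplied by c_1' c_2', gives the torsality determinant of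
    the characteristics along the curve c. *)
Definition torsal_factor (u lam Q mu : idx -> R -> R -> R) (i : idx) (x1 x2 : R) : R :=
  let o := other i in
  (pd i (lam i) x1 x2 * (mu i x1 x2 - mu o x1 x2)
   - (lam i x1 x2 - lam o x1 x2) * pd i (mu i) x1 x2)
  * det3 (l_dir u x1 x2) (focal u Q mu i x1 x2) (du u o x1 x2).

Lemma torsal_along D u F lam Q mu i (c : idx -> R -> R) s : open_2d D ->
  diagonal_flux D u F lam -> diagonal_flux D u Q mu -> coordinates D u ->
  regular_curve D c ->
  torsal (fun t => focal u F lam i (c I1 t) (c I2 t))
         (fun t => focal u Q mu i (c I1 t) (c I2 t)) s <->
  Derive (c I1) s * Derive (c I2) s
  * torsal_factor u lam Q mu i (c I1 s) (c I2 s) = 0.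
Proof.
intros OD HF HQ Cu Rc; destruct (Rc s) as (Cc & _ & Dc).
assert (Ec : forall k, ex_derive (c k) s) by (intros k; apply Cc).
assert (CF := Cn_on3_weaken 2 1 _ _ ltac:(lia) (focal_C2 D u F lam i OD HF)).
assert (CQ := Cn_on3_weaken 2 1 _ _ ltac:(lia) (focal_C2 D u Q mu i OD HQ)).
destruct (Derive3_along D _ c s i OD CF Dc Ec) as [_ EF].
destruct (Derive3_along D _ c s i OD CQ Dc Ec) as [_ EQ].
unfold torsal; rewrite EF, EQ, !(pd3_focal D) by assumption.
assert (R := commuting_velocities D u F lam Q mu i _ _ OD HF HQ Cu Dc).
match goal with |- ?X = 0 <-> ?Y = 0 => enough (E : X = Y) by now rewrite E end.
replace (Derive (c I1) s * Derive (c I2) s)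
  with (Derive (c i) s * Derive (c (other i)) s) by (destruct i; cbn; ring).
unfold torsal_factor; set (o := other i) in *.
revert R; generalize (pd o (lam i) (c I1 s) (c I2 s))
  (pd o (mu i) (c I1 s) (c I2 s)) (pd i (lam i) (c I1 s) (c I2 s))
  (pd i (mu i) (c I1 s) (c I2 s)) (Derive (c i) s) (Derive (c o) s).
set (T := l_dir u (c I1 s) (c I2 s)); set (U := du u o (c I1 s) (c I2 s)).
(* d_i u enters with the factor lam_i - lam_i = 0, resp. mu_i - mu_i = 0 *)
set (V := du u i (c I1 s) (c I2 s)).
set (d := focal u Q mu i (c I1 s) (c I2 s)).
generalize (lam i (c I1 s) (c I2 s)) (lam o (c I1 s) (c I2 s))
  (mu i (c I1 s) (c I2 s)) (mu o (c I1 s) (c I2 s)).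
clearbody T U V d; clear; intros li lo mi mo ol om il im ci co R.
(* the square of ci is absent as d_i r_i and d_i e_i are multiples of T; the
   coefficient of the square of co is cancelled by R *)
transitivity (co * (ci * (il * (mi - mo) - (li - lo) * im)
   + co * (ol * (mi - mo) - om * (li - lo))) * det3 T d U).
{ unfold det3; cbn; ring. }
rewrite R; ring.
Qed.

Lemma ruled_by_characteristic D u F lam Q mu i (c : idx -> R -> R) :
  open_2d D -> diagonal_flux D u F lam -> diagonal_flux D u Q mu ->
  (forall x1 x2, D x1 x2 -> Q I1 x1 x2 <> 0 \/ Q I2 x1 x2 <> 0) ->
  (forall x1 x2, D x1 x2 -> is_line (characteristic u F Q i x1 x2)) ->
  regular_curve D c ->
  ruled_by (along (characteristic u F Q i) c)
    (fun t => focal u F lam i (c I1 t) (c I2 t))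
    (fun t => focal u Q mu i (c I1 t) (c I2 t)).
Proof.
intros OD HF HQ NQ Li Rc s; destruct (Rc s) as (Cc & _ & Dc).
assert (Ec : forall k, ex_derive (c k) s) by (intros k; apply Cc).
assert (CF := Cn_on3_weaken 2 1 _ _ ltac:(lia) (focal_C2 D u F lam i OD HF)).
assert (CQ := Cn_on3_weaken 2 1 _ _ ltac:(lia) (focal_C2 D u Q mu i OD HQ)).
split; [apply (Derive3_along D _ c s i OD CF Dc Ec)|].
split; [apply (Derive3_along D _ c s i OD CQ Dc Ec)|].
split; [apply focal_neq_0; auto|].
intros y; apply (characteristic_line D); auto.
apply (wedge_neq_0 D u F lam Q mu); auto.
Qed.

(** A regular curve on which, at each point, one of the two coordinates is
    stationary is a coordinate curve. *)
Lemma coordinate_net_curve D c : regular_curve D c ->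
  (forall s, Derive (c I1) s * Derive (c I2) s = 0) ->
  net_curve (coord_field I1) (coord_field I2) c.
Proof.
intros Rc Z.
set (g := fun s => Derive (c I1) s * Derive (c I1) s
                   - Derive (c I2) s * Derive (c I2) s).
assert (Cd : forall k, continuity (Derive (c k))).
{ intros k s; apply continuity_pt_filterlim, (Rc s). }
assert (Cg : continuity g).
{ apply continuity_minus; apply continuity_mult; apply Cd. }
assert (gn : forall s, g s <> 0).
{ intros s E; unfold g in E; destruct (Rmult_integral _ _ (Z s)) as [K|K];
    destruct (Rc s) as (_ & [N|N] & _); apply N; nra. }
(* the continuous function g has no zero, hence a constant sign *)
assert (sgn : forall s, 0 < g 0 * g s).
{ intros s; destruct (Rlt_or_le 0 (g 0 * g s)) as [L|L]; [exact L|exfalso].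
  destruct (IVT_gen g 0 s 0 Cg) as (z & _ & Ez); [|exact (gn z Ez)].
  unfold Rmin, Rmax; destruct (Rle_dec (g 0) (g s)); nra. }
unfold net_curve, integral_curve; cbn.
destruct (Rlt_or_le 0 (g 0)) as [P|P]; [left|right]; intros s;
  specialize (sgn s); unfold g in sgn at 2;
  destruct (Rmult_integral _ _ (Z s)) as [K|K]; rewrite K in *; try lra; nra.
Qed.

Lemma characteristic_conjugate_focal D u F lam Q mu i : open_2d D ->
  diagonal_flux D u F lam -> diagonal_flux D u Q mu -> coordinates D u ->
  strictly_hyperbolic D lam ->
  (forall x1 x2, D x1 x2 -> Q I1 x1 x2 <> 0 \/ Q I2 x1 x2 <> 0) ->
  (forall x1 x2, D x1 x2 -> is_line (characteristic u F Q i x1 x2)) ->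
  regular_surface D (focal u F lam i) ->
  congruence_conjugate D (characteristic u F Q i) (focal u F lam i).
Proof.
intros OD HF HQ Cu hyp NQ Li reg.
exists (coord_field I1), (coord_field I2); split; [|split; [|split]].
- split; [|intros; cbn; lra].
  intros k; destruct k; split;
    (exact (Cn_on_const 1 D 1) || exact (Cn_on_const 1 D 0)).
- now apply focal_conjugate_net.
- intros x1 x2 Dx; apply (characteristic_line D u F lam Q mu); auto.
  + apply (wedge_neq_0 D u F lam Q mu); auto.
  + exists 0; apply A3_ext; cbn; ring.
- intros c Rc.
  assert (Ru := ruled_by_characteristic D u F lam Q mu i c OD HF HQ NQ Li Rc).
  split.
  + intros N; do 2 eexists; split; [exact Ru|]; intros s.
    apply (torsal_along D u F lam Q mu); auto.
    destruct N as [N|N]; specialize (N s); cbn in N.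
    * replace (Derive (c I2) s) with 0 by lra; ring.
    * replace (Derive (c I1) s) with 0 by lra; ring.
  + intros nd (p & d & Rpd & T); apply (coordinate_net_curve D); [exact Rc|].
    intros s.
    assert (Ts := torsal_change_of_generators _ _ _ _ _ s Rpd Ru (T s)).
    apply (torsal_along D u F lam Q mu) in Ts; auto.
    apply Rmult_integral in Ts; destruct Ts as [Ts|Ts]; [exact Ts|exfalso].
    destruct (nd s) as (c' & s' & p' & d' & Rc' & E1 & E2 & Rpd' & nT).
    apply nT.
    apply (torsal_change_of_generators _ _ _ _ _ s'
      (ruled_by_characteristic D u F lam Q mu i c' OD HF HQ NQ Li Rc') Rpd').
    apply (torsal_along D u F lam Q mu); auto.
    rewrite E1, E2, Ts; ring.
Qed.
Theorem mainTheorem5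
  (* domains of the Riemann invariants (R^1, R^2) and of the fields (u^1, u^2) *)
  (D V : R -> R -> Prop)
  (u lam mu : idx -> R -> R -> R) (* functions of R^1, R^2 *)
  (f q : idx -> R -> R -> R)      (* functions of u^1, u^2 *)
  (D_open : open_2d D) (V_open : open_2d V)
  (u_in_V : forall x1 x2, D x1 x2 -> V (u I1 x1 x2) (u I2 x1 x2))
  (u_C2 : forall k, Cn_on 2 D (u k))
  (lam_C2 : forall i, Cn_on 2 D (lam i))
  (mu_C2 : forall i, Cn_on 2 D (mu i))
  (f_C2 : forall k, Cn_on 2 V (f k))
  (q_C2 : forall k, Cn_on 2 V (q k))
  (u_coord : coordinates D u)
  (f_diag : diagonal_form D u f lam)
  (f_hyp : strictly_hyperbolic D lam)
  (fq_comm : commuting_flow V f q)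
  (q_diag : diagonal_form D u q mu) :
  let uf k := pull u (f k) in
  let uq k := pull u (q k) in
  (* the equation of pi is not void *)
  (forall x1 x2, D x1 x2 -> uq I1 x1 x2 <> 0 \/ uq I2 x1 x2 <> 0) ->
  (forall x1 x2, D x1 x2 ->
     forall y, congr_l u uf x1 x2 y -> plane_pi u uf uq x1 x2 y)
  /\
  (forall i : idx,
     (* l_i is a congruence of lines and r_i is a surface *)
     (forall x1 x2, D x1 x2 -> is_line (characteristic u uf uq i x1 x2)) ->
     regular_surface D (focal u uf lam i) ->
     congruence_conjugate D (characteristic u uf uq i) (focal u uf lam i)
     /\
     forall x1 x2, D x1 x2 ->
       line_tangent_at (congr_l u uf x1 x2) (focal u uf lam i) x1 x2
       /\ (forall y, characteristic u uf uq i x1 x2 y /\ congr_l u uf x1 x2 y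
                     <-> y = focal u uf lam i x1 x2)).
Proof.
intros uf uq NQ.
assert (HF : diagonal_flux D u uf lam).
{ split; auto; intros k; apply (Cn_on_pull_flux D V u f lam); auto;
    intros; apply (Cn_on_weaken 2); auto. }
assert (HQ : diagonal_flux D u uq mu).
{ split; auto; intros k; apply (Cn_on_pull_flux D V u q mu); auto;
    intros; apply (Cn_on_weaken 2); auto. }
split; [intros x1 x2 _; apply congr_l_in_plane|].
intros i Li reg; split; [now apply (characteristic_conjugate_focal D u uf lam uq mu)|].
intros x1 x2 Dx; split; [now apply (l_tangent_focal D)|].
intros y; rewrite (characteristic_line D u uf lam uq mu); auto.
- now apply characteristic_meets_l, NQ.
- apply (wedge_neq_0 D u uf lam uq mu); auto.
Qed.
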